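(* Let $r \geq 3$ and $n \geq r$ be integers, and let $\Gamma$ be an unbalanced signed graph on $n$ vertices that is $\mathcal{K}^-_{r+1}$-free, i.e., $\Gamma$ contains no unbalanced signed complete graph on $r+1$ vertices as a (signed) subgraph. Then $$\lambda_1(\Gamma) \leq \lambda_1(\Gamma_{1,r-2}),$$ with equality if and only if $\Gamma$ is switching equivalent to $\Gamma_{1,r-2}$.
   Context: A signed graph $\Gamma=(G,\sigma)$ is a simple graph $G$ together with a sign function $\sigma: E(G)\to\{-1,+1\}$. A cycle is positive if it contains an even number of negative edges and negative otherwise; $\Gamma$ is balanced if all its cycles are positive and unbalanced otherwise. $\mathcal{K}^-_{k}$ is the set of unbalanced signed complete graphs on $k$ vertices, and $\Gamma$ is $\mathcal{K}^-_{k}$-free if no subgraph of $\Gamma$ (with inherited signs) belongs to $\mathcal{K}^-_{k}$. The adjacency matrix $A(\Gamma)=(a_{ij})$ has $a_{ij}=\sigma(v_iv_j)$ if $v_i\sim v_j$ and $a_{ij}=0$ otherwise; $\lambda_1(\Gamma)$ (the index) is the largest eigenvalue of $A(\Gamma)$. For $U\subseteq V(\Gamma)$, switching with respect to $U$ reverses the signs of all edges between $U$ and $V(\Gamma)\setminus U$; two signed graphs are switching equivalent if one is obtained from the other by such a switching. $\Gamma_{1,r-2}$ denotes the signed graph on vertices $v_1,\dots,v_n$ obtained from the all-positive complete graph on $\{v_2,\dots,v_n\}$ by adding the vertex $v_1$ joined by one negative edge $v_1v_2$ and by $r-2$ positive edges $v_1v_3,\dots,v_1v_r$ (and no other edges at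 $v_1$). *)

(* Defs.v *)
From HB Require Import structures.
From mathcomp Require Import all_boot all_order all_algebra perm.
From mathcomp Require Import classical_sets reals.
Set Implicit Arguments. Unset Strict Implicit. Unset Printing Implicit Defensive.
Import Order.TTheory GRing.Theory Num.Theory.
Local Open Scope ring_scope.

(* A signed graph on vertex set 'I_n is given by an adjacency relation
   [adj] (symmetric, irreflexive) and a relation [neg] telling which pairs
   carry the sign -1 (only relevant on edges; assumed symmetric). *)
Definition is_signed_graph n (adj neg : rel 'I_n) : Prop :=
  [/\ symmetric adj, irreflexive adj & symmetric neg].

Definition sadj_mx (R : realType) n (adj neg : rel 'I_n) : 'M[R]_n :=
  \matrix_(i, j) (if adj i j then (if neg i j then -1 else 1) else 0).

(* Index lambda_1 : the largest eigenvalue (as the supremum of the finite,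
   nonempty set of real eigenvalues of a real symmetric matrix). *)
Definition lambda1 (R : realType) n (A : 'M[R]_n) : R :=
  sup [set x : R | eigenvalue A x]%classic.

Definition is_cycle n (adj : rel 'I_n) (c : seq 'I_n) : bool :=
  [&& 3 <= size c, uniq c & cycle adj c]%N.

Definition cycle_neg_edges n (neg : rel 'I_n) (c : seq 'I_n) : nat :=
  count (fun p => neg p.1 p.2) (zip c (rot 1 c)).

Definition negative_cycle n (adj neg : rel 'I_n) (c : seq 'I_n) : bool :=
  is_cycle adj c && odd (cycle_neg_edges neg c).

Definition unbalanced n (adj neg : rel 'I_n) : Prop :=
  exists c, negative_cycle adj neg c.

Definition contains_unbalanced_Kk n (adj neg : rel 'I_n) (k : nat) : Prop :=
  exists S : {set 'I_n},
    [/\ #|S| = k,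
        (forall i j, i \in S -> j \in S -> i != j -> adj i j) &
        exists c, negative_cycle adj neg c /\ all (fun v => v \in S) c].

Definition Kminus_free n (adj neg : rel 'I_n) (k : nat) : Prop :=
  ~ contains_unbalanced_Kk adj neg k.

Definition switch_neg n (U : {set 'I_n}) (neg : rel 'I_n) : rel 'I_n :=
  fun i j => neg i j (+) ((i \in U) != (j \in U)).

Definition switching_equivalent n (adj1 neg1 adj2 neg2 : rel 'I_n) : Prop :=
  exists (p : {perm 'I_n}) (U : {set 'I_n}),
    forall i j, adj2 (p i) (p j) = adj1 i j /\
      (adj1 i j -> neg2 (p i) (p j) = switch_neg U neg1 i j).

(* Gamma_{1,r-2} on vertices v_1..v_n (here indices 0..n-1): the all-positive
   complete graph on v_2..v_n, plus v_1 joined negatively to v_2 and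
   positively to v_3..v_r. *)
Definition G1_adj n (r : nat) : rel 'I_n :=
  fun i j => (i != j) &&
    [|| (0 < i) && (0 < j), (i == 0 :> nat) && (j < r) | (j == 0 :> nat) && (i < r)]%N.

Definition G1_neg n : rel 'I_n :=
  fun i j => ((i == 0 :> nat) && (j == 1 :> nat)) || ((i == 1 :> nat) && (j == 0 :> nat)).

Arguments G1_adj : clear implicits.
Arguments G1_neg : clear implicits.

(* Main.v *)
(* Switch so that a top eigenvector x of Gamma is nonnegative.  Then
   x A x^T = (sum x)^2 - |x|^2 - D, where D sums x_i x_j over ordered pairs, once
   for a non-edge and twice for a negative edge.  Since Gamma is unbalanced there
   is a negative edge uv; take it with x_u <= x_v.  Let a be a vertex minimising
   x (a = u if possible), order the vertices as u, v, a, ..., and let C be the set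
   of vertices j other than u, v forming a non-edge or a negative edge with some
   earlier i.  The complement of C is a clique whose only negative edge is uv, so
   |C| >= n - r.  Charging to each j in C one such pair, whose weight is at least
   x_a x_j, shows that D is at least the corresponding quantity for a copy of
   Gamma_{1,r-2} placed on the same vertices with v_1 = a and v_2 = v.
   In case of equality x is also a top eigenvector of that copy; its eigenvalue
   equations make x_a strictly smallest, unless no vertex is missed by v_1 or
   x_a = 0 (which forces r = 3), and the charging then identifies Gamma. *)

Require Import Defs.
From HB Require Import structures.
From mathcomp Require Import all_boot all_order all_algebra perm.
From mathcomp Require Import classical_sets reals.
From mathcomp Require Import fintype finset zify ring lra.
Import Order.TTheory GRing.Theory Num.Theory.
Local Open Scope ring_scope.

(** * Rayleigh quotients and the largest eigenvalue of a symmetric matrix *)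

Section Rayleigh.
Variables (R : realType) (n : nat).
Implicit Types (x y z : 'rV[R]_n) (A B : 'M[R]_n).

Definition dot x y : R := (x *m y^T) 0 0.
Definition qform A x : R := dot (x *m A) x.

Lemma dotE x y : dot x y = \sum_i x 0 i * y 0 i.
Proof. by rewrite /dot mxE; apply: eq_bigr => i _; rewrite mxE. Qed.

Lemma qformE A x : qform A x = \sum_i \sum_j x 0 i * x 0 j * A i j.
Proof.
rewrite /qform dotE exchange_big /=; apply: eq_bigr => j _.
by rewrite mxE mulr_suml; apply: eq_bigr => i _; rewrite mulrAC.
Qed.

Lemma dotC x y : dot x y = dot y x.
Proof. by rewrite !dotE; apply: eq_bigr => i _; rewrite mulrC. Qed.

Lemma dotDl x y z : dot (x + y) z = dot x z + dot y z.
Proof. by rewrite /dot mulmxDl mxE. Qed.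

Lemma dotZl a x y : dot (a *: x) y = a * dot x y.
Proof. by rewrite /dot -scalemxAl mxE. Qed.

Lemma dotDr x y z : dot z (x + y) = dot z x + dot z y.
Proof. by rewrite dotC dotDl !(dotC z). Qed.

Lemma dotZr a x y : dot y (a *: x) = a * dot y x.
Proof. by rewrite dotC dotZl dotC. Qed.

Lemma dot_ge0 x : 0 <= dot x x.
Proof. by rewrite dotE sumr_ge0 // => i _; rewrite -expr2 sqr_ge0. Qed.

Lemma dot_eq0 x : (dot x x == 0) = (x == 0).
Proof.
apply/idP/eqP => [|->]; last by rewrite /dot mul0mx mxE.
rewrite dotE psumr_eq0 => [/allP x0|i _]; last by rewrite -expr2 sqr_ge0.
apply/rowP => i; apply/eqP.
by have := x0 i (mem_index_enum _); rewrite mxE mulf_eq0 orbb.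
Qed.

Lemma dot_gt0 x : x != 0 -> 0 < dot x x.
Proof. by move=> x0; rewrite lt_neqAle dot_ge0 andbT eq_sym dot_eq0. Qed.

Lemma dot_mulmx A x y : A^T = A -> dot (x *m A) y = dot (y *m A) x.
Proof.
by move=> sA; rewrite [RHS]dotC /dot trmx_mul sA mulmxA.
Qed.

Lemma qform_lin A x y a b : A^T = A ->
  qform A (a *: x + b *: y) =
  a ^+ 2 * qform A x + a * b *+ 2 * dot (x *m A) y + b ^+ 2 * qform A y.
Proof.
move=> sA; rewrite /qform mulmxDl -!scalemxAl !(dotDl, dotDr, dotZl, dotZr).
by rewrite (dot_mulmx _ y x sA); ring.
Qed.

(** Nonnegativity of the form at the combination q(y) x - (xA . y) y is q(y) times the claim. When
    q(y) = 0 the form is affine along y, so it can stay nonnegative only if its slope vanishes. *)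
Lemma psd_Cauchy_Schwarz A x y : A^T = A -> (forall z, 0 <= qform A z) ->
  dot (x *m A) y ^+ 2 <= qform A x * qform A y.
Proof.
move=> sA psd.
have [qy0|qy_neq0] := eqVneq (qform A y) 0.
  rewrite qy0 mulr0.
  have [->|b0] := eqVneq (dot (x *m A) y) 0; first by rewrite expr0n.
  (* The coefficient of y is chosen so that the form takes the value -1. *)
  have := psd (1 *: x + (- (qform A x + 1) / (2 * dot (x *m A) y)) *: y).
  rewrite qform_lin // qy0.
  set q := qform A x; set b := dot _ _ in b0 *.
  have -> : 1 ^+ 2 * q + 1 * (- (q + 1) / (2 * b)) *+ 2 * b
     + (- (q + 1) / (2 * b)) ^+ 2 * 0 = -1 by field.
  by rewrite lerNr oppr0 ler10.
have qy_gt0 : 0 < qform A y by rewrite lt_neqAle psd andbT eq_sym.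
have := psd (qform A y *: x + (- dot (x *m A) y) *: y).
rewrite qform_lin // => H; rewrite -subr_ge0 -(pmulr_rge0 _ qy_gt0).
by apply: le_trans H _; rewrite le_eqVlt; apply/orP; left; apply/eqP; ring.
Qed.

(** Cauchy-Schwarz against y = xA bounds |xA|^4 by a product whose first factor is zero. *)
Lemma psd_kernel A x : A^T = A -> (forall z, 0 <= qform A z) ->
  qform A x = 0 -> x *m A = 0.
Proof.
move=> sA psd qx0; apply/eqP; rewrite -dot_eq0 -sqrf_eq0 eq_le sqr_ge0 andbT.
by apply: le_trans (psd_Cauchy_Schwarz _ x (x *m A) sA psd) _; rewrite qx0 mul0r.
Qed.

Lemma qform_bounded A : exists2 K, 0 < K & forall x, qform A x <= K * dot x x.
Proof.
pose K := \sum_i \sum_j `|A i j|.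
have K_ge0 : 0 <= K by apply: sumr_ge0 => i _; apply: sumr_ge0.
exists (K + 1); first by rewrite ltr_wpDl.
move=> x; apply: (@le_trans _ _ (K * dot x x)); last first.
  by rewrite ler_wpM2r ?dot_ge0 // lerDl.
have sq_le k : x 0 k ^+ 2 <= dot x x.
  rewrite dotE (bigD1 k) //= expr2 lerDl.
  by apply: sumr_ge0 => i _; rewrite -expr2 sqr_ge0.
rewrite qformE mulr_suml; apply: ler_sum => i _.
rewrite mulr_suml; apply: ler_sum => j _.
apply: le_trans (ler_norm _) _; rewrite normrM mulrC ler_wpM2l //.
rewrite ler_norml.
have := sq_le i; have := sq_le j.
(* The squares of x_i - x_j and x_i + x_j give |x_i x_j| <= (x_i^2 + x_j^2) / 2, hence at most
   |x|^2. *)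
have := sqr_ge0 (x 0 i - x 0 j); have := sqr_ge0 (x 0 i + x 0 j).
by move=> *; apply/andP; split; nra.
Qed.

Lemma qform_scalar_sub A m x : qform (m%:M - A) x = m * dot x x - qform A x.
Proof.
by rewrite /qform mulmxBr mul_mx_scalar dotDl dotZl -scaleN1r dotZl mulN1r.
Qed.

Lemma sym_scalar_sub A (m : R) : A^T = A -> (m%:M - A)^T = m%:M - A.
Proof. by move=> sA; rewrite linearB /= tr_scalar_mx sA. Qed.

(* If m, the supremum of the Rayleigh quotient, were not an eigenvalue, then
   Cauchy-Schwarz for the invertible form m - A would give
   |x|^2 <= K (m |x|^2 - A(x)), and m - 1/K would still be an upper bound. *)
Lemma max_eigenvalue A : (0 < n)%N -> A^T = A ->
  exists2 m, eigenvalue A m & forall x, qform A x <= m * dot x x.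
Proof.
move=> n_gt0 sA.
pose S := [set qform A x / dot x x | x in [set x | x != 0]]%classic.
have [K K_gt0 qK] := qform_bounded A.
have e_neq0 : delta_mx 0 (Ordinal n_gt0) != 0 :> 'rV[R]_n.
  apply/negP => /eqP/rowP/(_ (Ordinal n_gt0)); rewrite !mxE !eqxx /= => /eqP.
  by rewrite oner_eq0.
have supS : has_sup S.
  split; first by exists (qform A (delta_mx 0 (Ordinal n_gt0)) /
    dot (delta_mx 0 (Ordinal n_gt0)) (delta_mx 0 (Ordinal n_gt0)));
    exists (delta_mx 0 (Ordinal n_gt0)).
  by exists K => _ [x /= x0 <-]; rewrite ler_pdivrMr ?dot_gt0.
have qle x : qform A x <= sup S * dot x x.
  have [->|x0] := eqVneq x 0.
    by rewrite /qform mul0mx /dot mul0mx mxE mulr0.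
  rewrite -ler_pdivrMr ?dot_gt0 //; apply: ub_le_sup; first by case: supS.
  by exists x.
exists (sup S) => //.
set m := sup S in qle *.
have psd z : 0 <= qform (m%:M - A) z by rewrite qform_scalar_sub subr_ge0.
have sB := sym_scalar_sub A m sA.
have [Bu|Bnu] := boolP (m%:M - A \in unitmx); last first.
  rewrite /eigenvalue /eigenspace kermx_eq0 row_free_unit.
  by rewrite -(opprB (m%:M : 'M_n)) -scaleN1r unitmxZ // unitrN1.
have [L L_gt0 qL] := qform_bounded (invmx (m%:M - A)).
have : m <= m - L^-1.
  apply: ge_sup; first by case: supS.
  move=> _ [x /= x0 <-]; have dx := dot_gt0 _ x0.
  have := psd_Cauchy_Schwarz _ (x *m invmx (m%:M - A)) x sB psd.
  rewrite {1}/qform mulmxKV // [dot x (x *m _)]dotC -/(qform _ x) qform_scalar_sub => cs.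
  have pr_ge0 := psd x; rewrite qform_scalar_sub in pr_ge0.
  have {}cs : dot x x <= L * (m * dot x x - qform A x).
    rewrite -(ler_pM2r dx) -expr2; apply: le_trans cs _.
    by rewrite mulrAC; apply: ler_wpM2r; rewrite ?qL.
  rewrite ler_pdivrMr // mulrBl lerBrDl -lerBrDr.
  by rewrite -(ler_pM2l L_gt0) mulrA mulfV ?mul1r // gt_eqF.
by rewrite lerDl oppr_ge0 leNgt invr_gt0 L_gt0.
Qed.

Lemma eigenvalue_le A m a : (forall x, qform A x <= m * dot x x) ->
  eigenvalue A a -> a <= m.
Proof.
move=> qm /eigenvalueP [v vA v0]; have := qm v.
by rewrite /qform vA dotZl ler_pM2r // dot_gt0.
Qed.

(** A [sup] is meaningful only for a nonempty set that is bounded above. The maximum of the Rayleigh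
    quotient gives both: it is an eigenvalue, and it bounds all the others. *)
Lemma lambda1_spec A : (0 < n)%N -> A^T = A ->
  eigenvalue A (lambda1 A) /\ forall x, qform A x <= lambda1 A * dot x x.
Proof.
move=> n_gt0 sA; have [m em qm] := max_eigenvalue A n_gt0 sA.
suff -> : lambda1 A = m by [].
apply/eqP; rewrite eq_le; apply/andP; split.
  by apply: ge_sup; [exists m | move=> a /= /(eigenvalue_le _ _ _ qm)].
by apply: ub_le_sup => //; exists m => a /= /(eigenvalue_le _ _ _ qm).
Qed.

(** The form of lambda_1 - A is positive semidefinite and vanishes at x, so x lies in its kernel. *)
Lemma qform_max_eigenvector A x : (0 < n)%N -> A^T = A ->
  qform A x = lambda1 A * dot x x -> x *m A = lambda1 A *: x.
Proof.
move=> n_gt0 sA qx; have [_ qle] := lambda1_spec A n_gt0 sA.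
have := psd_kernel (((lambda1 A)%:M) - A) x (sym_scalar_sub A _ sA).
rewrite qform_scalar_sub qx subrr mulmxBr mul_mx_scalar => H.
apply/esym/eqP; rewrite -subr_eq0; apply/eqP; apply: H => // z.
by rewrite qform_scalar_sub subr_ge0.
Qed.

End Rayleigh.
Arguments dot {R n}.
Arguments qform {R n}.

Lemma lambda1_le (R : realType) n (A B : 'M[R]_n) : (0 < n)%N ->
  A^T = A -> B^T = B ->
  (forall x, exists2 y, dot y y = dot x x & qform A x <= qform B y) ->
  lambda1 A <= lambda1 B.
Proof.
move=> n_gt0 sA sB le; have [eA _] := lambda1_spec _ _ A n_gt0 sA.
have [_ qB] := lambda1_spec _ _ B n_gt0 sB.
apply: eigenvalue_le eA => x; have [y <- qAB] := le x.
exact: le_trans qAB (qB y).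
Qed.

Lemma card_subset_exists (T : finType) (A : {set T}) k : (k <= #|A|)%N ->
  exists2 B : {set T}, B \subset A & #|B| = k.
Proof.
move=> kA; exists [set x in take k (enum A)].
  by apply/subsetP => x; rewrite inE => /mem_take; rewrite mem_enum.
rewrite cardsE; have /card_uniqP -> := take_uniq k (enum_uniq A).
by rewrite size_take_min -cardE; apply/minn_idPl.
Qed.

(** * Switching and negative cycles *)

Section Switching.
Variables (n : nat) (adj neg : rel 'I_n).

(** The zip lists the consecutive pairs of the walk from x through s to y. Crossings of the boundary
    of U telescope to whether x and y are separated; with y = x this is the shape of a closed
    cycle. *)
Lemma odd_walk_switch (U : {set 'I_n}) x s y :
  odd (count (fun p => switch_neg U neg p.1 p.2) (zip (x :: s) (rcons s y))) =
  odd (count (fun p => neg p.1 p.2) (zip (x :: s) (rcons s y)))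
    (+) ((x \in U) != (y \in U)).
Proof.
elim: s x => [|z s IHs] x.
  by rewrite /= !addn0 !oddb.
rewrite rcons_cons [zip _ _]/= -/(zip (z :: s) (rcons s y)) /=.
have := IHs z; rewrite !oddD !oddb => -> /=; rewrite /switch_neg.
by case: (neg x z); case: (odd _); case: (x \in U); case: (y \in U); case: (z \in U).
Qed.

Lemma odd_cycle_switch (U : {set 'I_n}) c :
  odd (cycle_neg_edges (switch_neg U neg) c) = odd (cycle_neg_edges neg c).
Proof.
case: c => // x s; rewrite /cycle_neg_edges rot1_cons odd_walk_switch eqxx.
by rewrite addbF.
Qed.

Lemma walk_has_edge (P : rel 'I_n) x s y : path adj x (rcons s y) ->
  has (fun p => P p.1 p.2) (zip (x :: s) (rcons s y)) ->
  exists i j, adj i j /\ P i j.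
Proof.
elim: s x => [|z s IHs] x /=.
  by rewrite andbT orbF => xy Pxy; exists x, y.
case/andP => xz pz /orP [Pxz|hz]; first by exists x, z.
exact: IHs pz hz.
Qed.

(** A negative cycle stays negative under switching, and an odd count of negative edges is not
    zero. *)
Lemma unbalanced_switch_neg_edge (U : {set 'I_n}) : unbalanced adj neg ->
  exists i j, adj i j /\ switch_neg U neg i j.
Proof.
case=> c /andP [/and3P [_ _ cyc]]; rewrite -(odd_cycle_switch U).
case: c cyc => // x s cyc; rewrite /cycle_neg_edges rot1_cons => oddc.
by apply: (walk_has_edge _ _ _ _ cyc); rewrite has_count; case: count oddc.
Qed.

(** Otherwise u, v, w form a negative triangle after switching, hence also before, and the clique S
    is unbalanced. *)
Lemma Kminus_free_clique_triangle k (U S : {set 'I_n}) u v w :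
  symmetric neg -> Kminus_free adj neg k -> #|S| = k ->
  {in S &, forall i j, i != j -> adj i j} ->
  [/\ u \in S, v \in S & w \in S] -> [/\ u != v, u != w & v != w] ->
  switch_neg U neg u v -> switch_neg U neg u w || switch_neg U neg v w.
Proof.
move=> symn free cardS cl [uS vS wS] [uv uw vw] nuv; apply: contraT.
rewrite negb_or => /andP [nuw nvw]; case: free; exists S; split => //.
exists [:: u; v; w]; split; last by rewrite /= uS vS wS.
rewrite /negative_cycle -(odd_cycle_switch U) /cycle_neg_edges rot1_cons /=.
rewrite nuv (negbTE nvw) /is_cycle /= !inE negb_or uv uw vw /=.
rewrite !cl // 1?eq_sym //; rewrite /switch_neg symn in nuw.
by rewrite /switch_neg eq_sym (negbTE nuw).
Qed.

End Switching.

(** * Quadratic forms of defects, and the star-shaped defects of Gamma_{1,r-2} *)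

Definition defect_form (R : realType) n (c : 'I_n -> 'I_n -> nat)
  (x : 'rV[R]_n) : R := \sum_i \sum_j x 0 i * x 0 j * (c i j)%:R.

(* The defects of Gamma_{1,r-2} when a plays v_1, b plays v_2 and Z is the set
   of the n - r vertices not adjacent to v_1. *)
Definition star_defect n (a b : 'I_n) (Z : {set 'I_n}) (i j : 'I_n) : nat :=
  ((i == a) && (j == b)).*2 + ((i == b) && (j == a)).*2 +
  ((i == a) && (j \in Z)) + ((j == a) && (i \in Z)).

Arguments defect_form {R n}.
Arguments star_defect {n}.

Lemma star_defect_sym n (a b : 'I_n) (Z : {set 'I_n}) i j :
  star_defect a b Z i j = star_defect a b Z j i.
Proof.
by rewrite /star_defect (addnC (_.*2)) -!addnA (addnC (_ && _ : nat)) !(andbC (i == _)).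
Qed.

Lemma star_defect_diag n (a b : 'I_n) (Z : {set 'I_n}) i : a != b -> a \notin Z ->
  star_defect a b Z i i = 0%N.
Proof.
move=> ab aZ; rewrite /star_defect.
by have [->|_] := eqVneq i a; rewrite ?andbF ?(negbTE ab) ?(negbTE aZ).
Qed.

Lemma sum_if_eq (R : nmodType) (I : finType) (k : I) (F : R) :
  \sum_i (if i == k then F else 0) = F.
Proof. by rewrite -big_mkcond big_pred1_eq. Qed.

(** This column sum serves both the quadratic form and, later, the eigenvalue equations. *)
Lemma star_defect_col (R : realType) n (a b : 'I_n) Z (x : 'rV[R]_n) j :
  \sum_i x 0 i * (star_defect a b Z i j)%:R =
  (if j == b then x 0 a *+ 2 else 0) +
  (if j == a then x 0 b *+ 2 + \sum_(i in Z) x 0 i else 0) +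
  (if j \in Z then x 0 a else 0).
Proof.
transitivity (\sum_i ((if i == a then (x 0 a *+ 2) *+ (j == b) else 0) +
   (if i == b then (x 0 b *+ 2) *+ (j == a) else 0) +
   (if i == a then x 0 a *+ (j \in Z) else 0) +
   (if i \in Z then x 0 i *+ (j == a) else 0))).
  apply: eq_bigr => i _; rewrite /star_defect !natrD !mulrDr !mulr_natr.
  case: (j == a); case: (j == b); case: (j \in Z); case: (i \in Z);
  by case: (i =P a) => [<-|_]; case: (i =P b) => [<-|_];
    rewrite ?andbF /= -?muln2 ?mul0n ?mul1n ?mulr0n ?mulr1n ?addr0 ?add0r.
rewrite !big_split /= !sum_if_eq -big_mkcond /= sumrMnl.
by case: (j == a); case: (j == b); case: (j \in Z);
  rewrite /= ?mulr0n ?mulr1n; ring.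
Qed.

Lemma star_defect_form (R : realType) n (a b : 'I_n) Z (x : 'rV[R]_n) :
  defect_form (star_defect a b Z) x =
  (x 0 a * x 0 b *+ 2 + \sum_(i in Z) x 0 a * x 0 i) *+ 2.
Proof.
rewrite /defect_form exchange_big /=.
under eq_bigr => j _.
  under eq_bigr => i _ do rewrite (mulrC (x 0 i)) -mulrA.
  rewrite -mulr_sumr star_defect_col !mulrDr !(fun_if (fun z => x 0 j * z)) mulr0.
over.
rewrite !big_split /= -!big_mkcond /= !big_pred1_eq -!mulr_sumr -mulr_suml.
ring.
Qed.

(** * Defect sums along a vertex order *)

Section OrderedDefect.
Variables (R : realType) (n : nat) (c : 'I_n -> 'I_n -> nat).
Variables (x : 'rV[R]_n) (f : 'I_n -> nat).
Hypotheses (csym : forall i j, c i j = c j i) (cdiag : forall i, c i i = 0%N).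
Hypotheses (x_ge0 : forall i, 0 <= x 0 i) (f_inj : injective f).

(** Each pair is charged to its later endpoint, so lower bounds at distinct j never use the same
    pair. *)
Definition below j : R := \sum_(i | (f i < f j)%N) x 0 i * x 0 j * (c i j)%:R.

Lemma defect_form_below : defect_form c x = (\sum_j below j) *+ 2.
Proof.
rewrite /defect_form.
transitivity (\sum_i \sum_j
  ((if (f i < f j)%N then x 0 i * x 0 j * (c i j)%:R else 0) +
   (if (f j < f i)%N then x 0 j * x 0 i * (c j i)%:R else 0))).
  apply: eq_bigr => i _; apply: eq_bigr => j _.
  case: ltngtP => [_|_|/f_inj ->]; rewrite ?addr0 ?add0r ?cdiag ?mulr0 //.
  by rewrite csym (mulrC (x 0 i)).
under eq_bigr do rewrite big_split /= -!big_mkcond.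
rewrite big_split /= mulr2n; congr (_ + _); rewrite /below //.
under eq_bigr do rewrite big_mkcond.
rewrite exchange_big /=; apply: eq_bigr => j _.
by rewrite -big_mkcond.
Qed.

Lemma below_term_ge0 i j : 0 <= x 0 i * x 0 j * (c i j)%:R.
Proof. by rewrite !mulr_ge0. Qed.

Lemma below_ge0 j : 0 <= below j.
Proof. by apply: sumr_ge0 => i _; exact: below_term_ge0. Qed.

Lemma below_ge i j : (f i < f j)%N -> x 0 i * x 0 j * (c i j)%:R <= below j.
Proof.
move=> ij; rewrite /below (bigD1 i) //= lerDl.
by apply: sumr_ge0 => k _; exact: below_term_ge0.
Qed.

Lemma below_ge1 i j : (f i < f j)%N -> c i j != 0%N -> x 0 i * x 0 j <= below j.
Proof.
move=> ij cij; apply: le_trans (below_ge _ _ ij).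
by rewrite ler_peMr ?mulr_ge0 // ler1n lt0n.
Qed.

(** In the equality case this shows that a vertex whose charge is exhausted by one pair has no other
    earlier defect. *)
Lemma below_ge_pair i k j : (f i < f j)%N -> (f k < f j)%N -> i != k ->
  x 0 i * x 0 j * (c i j)%:R + x 0 k * x 0 j * (c k j)%:R <= below j.
Proof.
move=> ij kj ik; rewrite /below (bigD1 i) //= (bigD1 k) 1?kj 1?eq_sym //=.
rewrite lerD2l lerDl.
by apply: sumr_ge0 => l _; exact: below_term_ge0.
Qed.

End OrderedDefect.
Arguments below {R n}.
Arguments defect_form_below {R n c} x {f}.
Arguments below_ge {R n c x f}.
Arguments below_ge1 {R n c x f}.
Arguments below_ge_pair {R n c x f}.

(** Ranks 0, 1, 2 go to u, v, a, and the shift by 3 keeps the other vertices apart from them. For a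
    = u the rank 2 is simply not taken. *)
Definition rank3 n (u v a i : 'I_n) : nat :=
  if i == u then 0 else if i == v then 1 else if i == a then 2 else i.+3.

Lemma rank3_inj n (u v a : 'I_n) : injective (rank3 n u v a).
Proof.
move=> i j; rewrite /rank3.
do ![case: eqVneq => [->|?] //].
by move=> [] /val_inj.
Qed.
Arguments rank3 {n}.

(** * Comparison with the defects of a copy of Gamma_{1,r-2} *)

Section Comparison.
Variables (R : realType) (n r : nat) (c : 'I_n -> 'I_n -> nat) (x : 'rV[R]_n).
Hypotheses (csym : forall i j, c i j = c j i) (cdiag : forall i, c i i = 0%N).
Hypothesis x_ge0 : forall i, 0 <= x 0 i.
(** The form in which freeness from unbalanced complete graphs enters here;
    [Kminus_free_clique_bound] establishes it. *)
Hypothesis clique_bound : forall (u v : 'I_n) (S : {set 'I_n}), c u v = 2%N ->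
  u \in S -> v \in S ->
  {in S &, forall i j, i != j -> (i \in [set u; v]) && (j \in [set u; v]) || (c i j == 0%N)} ->
  (#|S| <= r)%N.

(* The later endpoints of defective pairs other than {u, v}, in the vertex
   order f: outside this set all pairs but {u, v} are positive edges. *)
Definition hit (f : 'I_n -> nat) (u v : 'I_n) : {set 'I_n} :=
  [set j | [&& j != u, j != v & [exists i, (f i < f j)%N && (c i j != 0%N)]]].

(** The complement contains u and v, and any other pair inside it has defect 0, since its later
    endpoint would otherwise be hit; so [clique_bound] applies to it. *)
Lemma card_hit f u v : injective f -> f u = 0%N -> f v = 1%N ->
  c u v = 2%N -> (n - r <= #|hit f u v|)%N.
Proof.
move=> f_inj fu fv cuv; rewrite leq_subLR addnC -leq_subLR.
have -> : (n - #|hit f u v|)%N = #|~: hit f u v|.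
  have := cardsC (hit f u v); rewrite card_ord => e; lia.
apply: (clique_bound u v); rewrite ?inE ?eqxx ?andbF //.
have ordered i j : j \notin hit f u v -> (f i < f j)%N ->
    (i \in [set u; v]) && (j \in [set u; v]) || (c i j == 0%N).
  rewrite !inE; have [->|ju] /= := eqVneq j u; first by rewrite fu.
  have [->|jv] /= := eqVneq j v => nex fij.
    by rewrite (f_inj i u) ?eqxx // fu; move: fij; rewrite fv; case: (f i).
  rewrite andbF /=; apply: contraNT nex => cij.
  by apply/existsP; exists i; rewrite fij.
move=> i j; rewrite !in_setC => iS jS ij.
case: (ltngtP (f i) (f j)) => [fij|fji|/f_inj e]; last by rewrite e eqxx in ij.
  exact: ordered.
by rewrite andbC csym; exact: ordered.
Qed.

(** The equality clause is conditional because strict minimality of x_a follows only from the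
    eigenvalue equations of the copy, and that copy is produced here. *)
Lemma star_defect_form_le : (r <= n)%N -> (exists u v, c u v = 2%N) ->
  exists a b (Z : {set 'I_n}),
    [/\ a != b, a \notin Z, b \notin Z & #|Z| = (n - r)%N] /\
    [/\ forall i, x 0 a <= x 0 i,
        defect_form (star_defect a b Z) x <= defect_form c x &
        defect_form (star_defect a b Z) x = defect_form c x ->
        c a b = 2%N /\
        (0 < x 0 a -> (Z != set0 -> forall i, i != a -> x 0 a < x 0 i) ->
         forall i j, c i j = star_defect a b Z i j)].
Proof.
move=> rn [u0 [v0 cuv0]].
have [u [v [cuv xuv]]] : exists u v, c u v = 2%N /\ x 0 u <= x 0 v.
  case: (leP (x 0 u0) (x 0 v0)) => [le|/ltW le]; first by exists u0, v0.
  by exists v0, u0; rewrite csym.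
have uv : u != v by apply: contra_eq_neq cuv => ->; rewrite cdiag.
have [umin|] := boolP [forall i, x 0 u <= x 0 i].
- pose f := rank3 u v u.
  have f_inj : injective f := rank3_inj _ _ _ _.
  have fu : f u = 0%N by rewrite /f /rank3 eqxx.
  have fv : f v = 1%N by rewrite /f /rank3 eqxx eq_sym (negbTE uv).
  have [Z ZC cardZ] := card_subset_exists _ _ _ (card_hit _ _ _ f_inj fu fv cuv).
  have ZP j : j \in Z -> [/\ j != u, j != v & exists2 i, (f i < f j)%N & c i j != 0%N].
    move=> /(subsetP ZC); rewrite inE => /and3P [ju jv /existsP [i /andP [? ?]]].
    by split=> //; exists i.
  have xu_min := forallP umin.
  have uZ : u \notin Z by apply/negP => /ZP [/eqP].
  have vZ : v \notin Z by apply/negP => /ZP [_ /eqP].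
  (* The share of the star form charged to j; it will be compared with [below] vertex by vertex. *)
  pose e j : R := (if j == v then x 0 u * x 0 v *+ 2 else 0) +
                  (if j \in Z then x 0 u * x 0 j else 0).
  have sum_e : defect_form (star_defect u v Z) x = (\sum_j e j) *+ 2.
    by rewrite star_defect_form big_split /= sum_if_eq -big_mkcond.
  have e_le j : e j <= below c x f j.
    rewrite /e; have [->|jv] := eqVneq j v.
      rewrite (negbTE vZ) addr0.
      by have := @below_ge _ _ c x f x_ge0 u v; rewrite fu fv cuv mulr_natr; apply.
    rewrite add0r; case: ifP => [/ZP [_ _ [i fij cij]]|_]; last exact: below_ge0.
    apply: le_trans (below_ge1 x_ge0 _ _ fij cij).
    by rewrite ler_wpM2r.
  exists u, v, Z; split; first by [].
  split=> //; rewrite sum_e (defect_form_below _ csym cdiag f_inj).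
    by rewrite lerMn2r /=; apply: ler_sum.
  move=> /(pmulrnI (ltn0Sn 1)) eqs; split=> // xu_gt0 xu_lt.
  (* Nonnegative differences with zero sum all vanish. *)
  have below_e j : below c x f j = e j.
    apply/eqP; rewrite -subr_eq0; apply/eqP.
    apply: (@psumr_eq0P _ _ xpredT (fun j => below c x f j - e j)) => // [k _|].
      by rewrite subr_ge0.
    by rewrite sumrB eqs subrr.
  have x_gt0 i : 0 < x 0 i := lt_le_trans xu_gt0 (xu_min i).
  have ordered i j : (f i < f j)%N -> c i j = star_defect u v Z i j.
    have [->|ju] := eqVneq j u; first by rewrite fu.
    have [->|jv fij] := eqVneq j v.
      rewrite fv; case fi: (f i) => // _.
      have -> : i = u by apply: f_inj; rewrite fu.
      by rewrite cuv /star_defect !eqxx (negbTE vZ) (negbTE uZ) (negbTE uv) !andbF.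
    have be := below_e j; rewrite /e (negbTE jv) add0r in be.
    have -> : star_defect u v Z i j = (i == u) && (j \in Z).
      by rewrite /star_defect (negbTE ju) (negbTE jv) !andbF addn0.
    (* Outside Z the charge is zero while all coordinates are positive, so j has no earlier
       defect. *)
    case: ifP be => [jZ|jZ] be; last first.
      rewrite andbF; apply/eqP.
      have := @below_ge _ _ c x f x_ge0 i j fij; rewrite be.
      by rewrite pmulr_rle0 ?mulr_gt0 // lern0.
    have /xu_lt {}xu_lt : Z != set0 by apply/set0Pn; exists j.
    have [_ _ [k fkj ckj]] := ZP _ jZ.
    (* Any other k has x_k > x_u, and the pair k, j would exceed the charge x_u x_j. *)
    have ku : k = u.
      apply/eqP; apply: contraT => /xu_lt; rewrite ltNge.
      have := below_ge1 x_ge0 _ _ fkj ckj.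
      by rewrite be ler_pM2r // => ->.
    subst k; rewrite andbT; have [->|iu] := eqVneq i u.
      have := @below_ge _ _ c x f x_ge0 u j fkj; rewrite be.
      rewrite ger_pMr ?mulr_gt0 // lern1.
      by case: (c u j) ckj => [|[|]].
    (* The pair u, j already uses up the charge of j, which leaves no defect for i. *)
    have := @below_ge_pair _ _ c x f x_ge0 i u j fij fkj iu; rewrite be => le1.
    have : x 0 u * x 0 j <= x 0 u * x 0 j * (c u j)%:R.
      by rewrite ler_peMr ?mulr_ge0 // ler1n lt0n.
    move=> le2; have := le_trans (lerD (lexx (x 0 i * x 0 j * (c i j)%:R)) le2) le1.
    by rewrite gerDr pmulr_rle0 ?mulr_gt0 // lern0 => /eqP.
  move=> i j; case: (ltngtP (f i) (f j)) => [|fji|/f_inj ->]; first exact: ordered.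
    by rewrite csym star_defect_sym; exact: ordered.
  by rewrite cdiag star_defect_diag.
rewrite negb_forall => /existsP [i0]; rewrite -ltNge => xi0.
have [a _ amin] := @arg_minP _ R _ i0 xpredT (fun i => x 0 i) isT.
have {}amin i : x 0 a <= x 0 i by exact: amin.
have xau : x 0 a < x 0 u := le_lt_trans (amin i0) xi0.
have au : a != u by apply: contraTneq xau => ->; rewrite ltxx.
have av : a != v by apply: contraTneq xau => ->; rewrite ltNge xuv.
pose f := rank3 u v a.
have f_inj : injective f := rank3_inj _ _ _ _.
have fu : f u = 0%N by rewrite /f /rank3 eqxx.
have fv : f v = 1%N by rewrite /f /rank3 eqxx eq_sym (negbTE uv).
have fa : f a = 2%N by rewrite /f /rank3 eqxx (negbTE au) (negbTE av).
pose C := hit f u v.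
have CP j : j \in C -> [/\ j != u, j != v & exists2 i, (f i < f j)%N & c i j != 0%N].
  rewrite inE => /and3P [ju jv /existsP [i /andP [? ?]]].
  by split=> //; exists i.
have uC : u \notin C by apply/negP => /CP [/eqP].
have vC : v \notin C by apply/negP => /CP [_ /eqP].
(* The vertex a is not in its own set Z; when it is in C its partner is u or v,
   of weight at least x_a x_u, and this defect pays for having u in Z instead. *)
pose C' := if a \in C then u |: C :\ a else C.
have cardC' : (n - r <= #|C'|)%N.
  suff -> : #|C'| = #|C| by exact: card_hit.
  rewrite /C'; case: ifP => // aC.
  by rewrite cardsU1 in_setD1 (negbTE uC) andbF (cardsD1 a C) aC.
have [Z ZC cardZ] := card_subset_exists _ _ _ cardC'.
have aC' : a \notin C'.
  by rewrite /C'; case: ifP => [_|->//]; rewrite in_setU1 in_setD1 eqxx (negbTE au).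
have vC' : v \notin C'.
  by rewrite /C'; case: ifP => // _; rewrite in_setU1 in_setD1 (negbTE vC) andbF orbF eq_sym.
pose e j : R := (if j == v then x 0 u * x 0 v *+ 2 else 0) +
                (if j \in C then (if j == a then x 0 a * x 0 u else x 0 a * x 0 j) else 0).
have e_le j : e j <= below c x f j.
  rewrite /e; have [->|jv] := eqVneq j v.
    rewrite (negbTE vC) addr0.
    by have := @below_ge _ _ c x f x_ge0 u v; rewrite fu fv cuv mulr_natr; apply.
  rewrite add0r; case: ifP => [/CP [_ _ [i fij cij]]|_]; last exact: below_ge0.
  apply: le_trans (below_ge1 x_ge0 _ _ fij cij).
  case: eqP => [ja|_]; last by rewrite ler_wpM2r.
  rewrite ja mulrC ler_wpM2r //; move: fij; rewrite ja fa.
  case fi: (f i) => [|[|]] // _; last by rewrite (f_inj i v) // fv.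
  by rewrite (f_inj i u) // fu.
(* When x_u is not minimal the inequality is strict and the equality clause is vacuous: the negative
   edge costs 2 x_a x_v in the copy, less than 2 x_u x_v. *)
suff lt : defect_form (star_defect a v Z) x < defect_form c x.
  exists a, v, Z; split.
    by split=> //; [apply: contra aC' | apply: contra vC']; apply: subsetP.
  by split=> //; [exact: ltW | move=> eq; rewrite eq ltxx in lt].
rewrite star_defect_form (defect_form_below _ csym cdiag f_inj) ltrMn2r /=.
apply: lt_le_trans (ler_sum _ (fun j _ => e_le j)).
rewrite big_split /= sum_if_eq -big_mkcond /=.
have xv_gt0 : 0 < x 0 v by apply: lt_le_trans xuv; apply: le_lt_trans xau.
apply: ltr_leD; first by rewrite ltrMn2r /= ltr_pM2r.
apply: (@le_trans _ _ (\sum_(j in C') x 0 a * x 0 j)).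
  rewrite big_mkcond [leRHS]big_mkcond /=; apply: ler_sum => j _.
  case: ifP => [/(subsetP ZC) ->//|_].
  by case: ifP => // _; rewrite mulr_ge0.
rewrite /C'; case: ifP => aC; last first.
  by apply: ler_sum => j jC; case: eqP jC => // ->; rewrite aC.
rewrite big_setU1 ?in_setD1 ?(negbTE uC) ?andbF //= [leRHS](big_setD1 a) //= eqxx.
rewrite lerD2l; apply: ler_sum => j; rewrite in_setD1 => /andP [/negbTE -> _].
exact: lexx.
Qed.

End Comparison.

(** * Defects of a signed graph and its adjacency matrix *)

(* 1 minus the (i, j) entry of the adjacency matrix, off the diagonal. *)
Definition defect n (adj neg : rel 'I_n) (i j : 'I_n) : nat :=
  if i == j then 0 else if adj i j then (neg i j).*2 else 1.
Arguments defect {n}.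

Lemma defect_eq0 n (adj neg : rel 'I_n) i j : i != j ->
  (defect adj neg i j == 0%N) = adj i j && ~~ neg i j.
Proof. by rewrite /defect => /negbTE ->; case: (adj i j); case: (neg i j). Qed.

Lemma defect_eq2 n (adj neg : rel 'I_n) i j :
  (defect adj neg i j == 2) = [&& i != j, adj i j & neg i j].
Proof. by rewrite /defect; case: (i == j); case: (adj i j); case: (neg i j). Qed.

Lemma defect_sym n (adj neg : rel 'I_n) i j :
  symmetric adj -> symmetric neg -> defect adj neg i j = defect adj neg j i.
Proof. by move=> sa sn; rewrite /defect eq_sym sa sn. Qed.

Lemma switch_neg_sym n (U : {set 'I_n}) (neg : rel 'I_n) :
  symmetric neg -> symmetric (switch_neg U neg).
Proof. by move=> sn i j; rewrite /switch_neg sn eq_sym. Qed.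

(** This is J - I - c with J the all-ones matrix. For a fixed x the contributions of J and I do not
    depend on the graph, so comparing quadratic forms means comparing defect forms. *)
Definition defect_mx (R : realType) n (c : 'I_n -> 'I_n -> nat) : 'M[R]_n :=
  \matrix_(i, j) (1 - (i == j)%:R - (c i j)%:R).
Arguments defect_mx R {n}.

Lemma sadj_mx_defect (R : realType) n (adj neg : rel 'I_n) :
  irreflexive adj -> sadj_mx R adj neg = defect_mx R (defect adj neg).
Proof.
move=> irr; apply/matrixP => i j; rewrite !mxE /defect.
have [->|_] := eqVneq i j; first by rewrite irr subrr subr0.
by case: (adj i j); case: (neg i j); rewrite /= -?muln2 ?mul1n; ring.
Qed.

Lemma defect_mx_sym (R : realType) n (c : 'I_n -> 'I_n -> nat) :
  (forall i j, c i j = c j i) -> (defect_mx R c)^T = defect_mx R c.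
Proof. by move=> cs; apply/matrixP => i j; rewrite !mxE eq_sym cs. Qed.

Lemma mul_defect_mx (R : realType) n c (x : 'rV[R]_n) j :
  (x *m defect_mx R c) 0 j =
  \sum_i x 0 i - x 0 j - \sum_i x 0 i * (c i j)%:R.
Proof.
rewrite mxE -[x 0 j](sum_if_eq _ _ j) -!sumrB; apply: eq_bigr => i _.
by rewrite mxE; case: eqP => [->|_] /=; ring.
Qed.

Lemma qform_defect (R : realType) n c (x : 'rV[R]_n) :
  qform (defect_mx R c) x = (\sum_i x 0 i) ^+ 2 - dot x x - defect_form c x.
Proof.
rewrite /qform !dotE; under eq_bigr => j _ do rewrite mul_defect_mx !mulrBl.
rewrite !sumrB -mulr_sumr -expr2 /defect_form exchange_big /=; congr (_ - _).
by apply: eq_bigr => j _; rewrite mulr_suml; apply: eq_bigr => i _; rewrite mulrAC.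
Qed.

(** * Invariance of the index under signed permutations *)

Lemma signed_perm_isometry (R : realType) n (A B : 'M[R]_n) (p : {perm 'I_n})
    (s : 'I_n -> R) (x : 'rV[R]_n) :
  (forall i, s i * s i = 1) ->
  (forall i j, A i j = s i * s j * B (p i) (p j)) ->
  exists y : 'rV[R]_n, [/\ forall i, y 0 (p i) = s i * x 0 i, dot y y = dot x x
              & qform B y = qform A x].
Proof.
move=> ss AB; exists (\row_k (s (p^-1%g k) * x 0 (p^-1%g k))).
have yE i : (\row_k (s (p^-1%g k) * x 0 (p^-1%g k))) 0 (p i) = s i * x 0 i.
  by rewrite mxE permK.
split=> //.
  rewrite !dotE (reindex_inj (@perm_inj _ p)); apply: eq_bigr => i _.
  by rewrite yE mulrACA ss mul1r.
rewrite !qformE (reindex_inj (@perm_inj _ p)); apply: eq_bigr => i _.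
rewrite (reindex_inj (@perm_inj _ p)); apply: eq_bigr => j _.
by rewrite !yE AB; ring.
Qed.

Lemma lambda1_signed_perm (R : realType) n (A B : 'M[R]_n) (p : {perm 'I_n})
    (s : 'I_n -> R) :
  (0 < n)%N -> A^T = A -> B^T = B -> (forall i, s i * s i = 1) ->
  (forall i j, A i j = s i * s j * B (p i) (p j)) -> lambda1 A = lambda1 B.
Proof.
move=> n_gt0 sA sB ss AB; apply/eqP; rewrite eq_le.
apply/andP; split; apply: lambda1_le => // x.
  by have [y [_ dy qy]] := signed_perm_isometry _ _ _ _ _ _ x ss AB; exists y; rewrite ?qy.
(* The inverse permutation with transported signs gives the converse inequality. *)
have BA i j : B i j = s (p^-1%g i) * s (p^-1%g j) * A (p^-1%g i) (p^-1%g j).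
  rewrite AB !permKV mulrA.
  by rewrite mulrACA !ss !mul1r.
have ss' i : s (p^-1%g i) * s (p^-1%g i) = 1 by rewrite ss.
by have [y [_ dy qy]] := signed_perm_isometry _ _ _ _ _ (fun i => s (p^-1%g i)) x ss' BA;
  exists y; rewrite ?qy.
Qed.

Lemma lambda1_defect_perm (R : realType) n (c d : 'I_n -> 'I_n -> nat) (p : {perm 'I_n}) :
  (0 < n)%N -> (forall i j, c i j = c j i) -> (forall i j, d i j = d j i) ->
  (forall i j, d (p i) (p j) = c i j) ->
  lambda1 (defect_mx R c) = lambda1 (defect_mx R d).
Proof.
move=> n_gt0 cs ds dc.
apply: (lambda1_signed_perm _ _ _ _ p (fun=> 1)) => // [||i|i j];
  try exact: defect_mx_sym; first by rewrite mulr1.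
by rewrite !mxE dc (inj_eq perm_inj) !mul1r.
Qed.

(** The basis vector e_i has Rayleigh quotient A i i = 0. *)
Lemma lambda1_ge0 (R : realType) n (A : 'M[R]_n) i :
  (0 < n)%N -> A^T = A -> A i i = 0 -> 0 <= lambda1 A.
Proof.
move=> n_gt0 sA Aii; have [_ /(_ (delta_mx 0 i))] := lambda1_spec _ _ A n_gt0 sA.
have dot_delta (y : 'rV[R]_n) : dot y (delta_mx 0 i) = y 0 i.
  rewrite dotE (bigD1 i) //= big1 ?addr0 ?mxE ?eqxx ?mulr1 // => j ji.
  by rewrite mxE (negbTE ji) mulr0.
by rewrite /qform -rowE !dot_delta !mxE !eqxx Aii mulr1.
Qed.

(** * Copies of Gamma_{1,r-2}, switching equivalence and the clique bound *)

Lemma G1_symmetric n r : symmetric (G1_adj n r).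
Proof.
by move=> i j; rewrite /G1_adj eq_sym (andbC (0 < i)%N) [X in _ || X]orbC.
Qed.

Lemma G1_irreflexive n r : irreflexive (G1_adj n r).
Proof. by move=> i; rewrite /G1_adj eqxx. Qed.

Lemma G1_neg_symmetric n : symmetric (G1_neg n).
Proof. by move=> i j; rewrite /G1_neg orbC; congr (_ || _); exact: andbC. Qed.

(** Each vertex is sent to its position in the list a, b, W, Z. Positions start at 0, so a and b
    become v_1 and v_2, and Z occupies the positions from r on, those not adjacent to v_1. *)
Lemma star_placement n r (a b : 'I_n) (Z : {set 'I_n}) :
  (2 <= r)%N -> (r <= n)%N -> a != b -> a \notin Z -> b \notin Z -> #|Z| = (n - r)%N ->
  exists p : {perm 'I_n}, forall i j,
    defect (G1_adj n r) (G1_neg n) (p i) (p j) = star_defect a b Z i j.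
Proof.
move=> r2 rn ab aZ bZ cardZ.
pose W := ~: (a |: (b |: Z)); pose s := a :: b :: enum W ++ enum Z.
have cardW : #|W| = (r - 2)%N.
  have := cardsC (a |: (b |: Z)).
  rewrite !cardsU1 !inE (negbTE ab) (negbTE aZ) bZ cardZ card_ord /= -/W.
  by move=> e; lia.
have all_s i : i \in s.
  rewrite !inE mem_cat !mem_enum !inE.
  by case: (i == a); case: (i == b); case: (i \in Z).
have size_s : size s = n by rewrite /= size_cat -!cardE cardW cardZ; lia.
have idx_lt i : (index i s < n)%N by rewrite -{2}size_s index_mem.
pose g i : 'I_n := Ordinal (idx_lt i).
have g_inj : injective g.
  by move=> i j /(congr1 val) /= e; rewrite -(nth_index a (all_s i)) [index _ _]e nth_index.
have ga i : (g i == 0 :> nat) = (i == a) by rewrite /= [i == a]eq_sym; case: (a == i).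
have gb i : (g i == 1 :> nat) = (i == b).
  rewrite /= [i == b]eq_sym; case: (eqVneq a i) => [<-|ai].
    by rewrite [b == a]eq_sym (negbTE ab).
  by case: (b == i).
have gZ i : (r <= g i)%N = (i \in Z).
  rewrite /=; case: eqP => [<-|ai]; first by rewrite (negbTE aZ); lia.
  case: eqP => [<-|bi]; first by rewrite (negbTE bZ); lia.
  rewrite index_cat mem_enum.
  have iWZ : (i \in W) = (i \notin Z).
    by rewrite !inE ![i == _]eq_sym (introF eqP ai) (introF eqP bi).
  case: ifP => [iW|]; last by rewrite iWZ -cardE cardW => /negbFE ->; lia.
  have : (index i (enum W) < #|W|)%N by rewrite cardE index_mem mem_enum.
  move: iW; rewrite iWZ => /negbTE ->; rewrite cardW; move: (index _ _) => k lt.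
  by apply/negbTE; rewrite -ltnNge; lia.
exists (perm g_inj) => i j; rewrite !permE /defect (inj_eq g_inj).
have [->|ij] := eqVneq i j; first by rewrite star_defect_diag.
rewrite /G1_adj /G1_neg (inj_eq g_inj) ij !lt0n !ga !gb !ltnNge !gZ /star_defect /=.
have [ia|ia] := eqVneq i a; have [ja|ja] := eqVneq j a.
- by rewrite ia ja eqxx in ij.
- rewrite ia (negbTE ab) (negbTE aZ) /=.
  have [->|jb] := eqVneq j b; first by rewrite (negbTE bZ).
  by case: (j \in Z).
- rewrite ja (negbTE ab) (negbTE aZ) /=.
  have [->|jb] := eqVneq i b; first by rewrite (negbTE bZ).
  by case: (i \in Z).
by rewrite !andbF.
Qed.

(** Off the diagonal the defect encodes the graph: 1 is a non-edge, 0 and 2 are the two signs of an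
    edge. Equal defects therefore give a switching isomorphism. *)
Lemma defect_star_switching n r (adj neg : rel 'I_n) (U Z : {set 'I_n}) a b :
  irreflexive adj ->
  (2 <= r)%N -> (r <= n)%N -> a != b -> a \notin Z -> b \notin Z -> #|Z| = (n - r)%N ->
  (forall i j, defect adj (switch_neg U neg) i j = star_defect a b Z i j) ->
  switching_equivalent adj neg (G1_adj n r) (G1_neg n).
Proof.
move=> irr r2 rn ab aZ bZ cardZ star.
have [p pstar] := star_placement _ _ _ _ _ r2 rn ab aZ bZ cardZ.
exists p, U => i j; have := pstar i j; rewrite -star /defect (inj_eq perm_inj).
have [->|ij] := eqVneq i j; first by rewrite G1_irreflexive irr.
by case: (adj i j); case: (G1_adj _ _ _ _); case: (G1_neg _ _ _);
  case: (switch_neg _ _ _ _).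
Qed.

Lemma switching_equivalent_lambda1 (R : realType) n (adj1 neg1 adj2 neg2 : rel 'I_n) :
  (0 < n)%N -> is_signed_graph adj1 neg1 -> is_signed_graph adj2 neg2 ->
  switching_equivalent adj1 neg1 adj2 neg2 ->
  lambda1 (sadj_mx R adj1 neg1) = lambda1 (sadj_mx R adj2 neg2).
Proof.
move=> n_gt0 [sa1 ia1 sn1] [sa2 ia2 sn2] [p [U eqv]].
(* Switching at U is conjugation by the diagonal matrix with -1 exactly on U. *)
apply: (lambda1_signed_perm _ _ _ _ p (fun i => (-1) ^+ (i \in U))) => //.
- by rewrite sadj_mx_defect // defect_mx_sym // => i j; exact: defect_sym.
- by rewrite sadj_mx_defect // defect_mx_sym // => i j; exact: defect_sym.
- by move=> i; rewrite -expr2 sqrr_sign.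
move=> i j; rewrite !mxE; have [-> ] := eqv i j.
case: (adj1 i j) => [/(_ isT) ->|_]; last by rewrite mulr0.
rewrite /switch_neg.
by case: (i \in U); case: (j \in U); case: (neg1 i j); rewrite /= ?expr0 ?expr1; ring.
Qed.

(** A larger S is trimmed to u, v and r - 1 further vertices. For any further vertex w, the triangle
    u, v, w has uv as its only negative edge, so this clique on r + 1 vertices is unbalanced. *)
Lemma Kminus_free_clique_bound n r (adj neg : rel 'I_n) (U : {set 'I_n}) :
  (3 <= r)%N -> is_signed_graph adj neg -> Kminus_free adj neg r.+1 ->
  let c := defect adj (switch_neg U neg) in
  forall (u v : 'I_n) (S : {set 'I_n}), c u v = 2%N -> u \in S -> v \in S ->
  {in S &, forall i j, i != j ->
     (i \in [set u; v]) && (j \in [set u; v]) || (c i j == 0%N)} ->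
  (#|S| <= r)%N.
Proof.
move=> r3 [sa irr sn] free c u v S cuv uS vS clS; rewrite leqNgt; apply/negP => rS.
have /and3P [uv auv nuv] : [&& u != v, adj u v & switch_neg U neg u v].
  by rewrite -defect_eq2; apply/eqP.
have cardT : (r.-1 <= #|S :\ u :\ v|)%N.
  move: rS; rewrite (cardsD1 u S) uS (cardsD1 v (S :\ u)) in_setD1 (eq_sym v) uv vS /=.
  by move: #|S :\ u :\ v| => m; lia.
have [T TS cardTr] := card_subset_exists _ _ _ cardT.
have TP i : i \in T -> [/\ i != v, i != u & i \in S].
  by move/(subsetP TS); rewrite !in_setD1 => /and3P [].
have uT : u \notin T by apply/negP => /TP [_ /eqP].
have vT : v \notin T by apply/negP => /TP [/eqP].
have [w wT] : exists w, w \in T by apply/card_gt0P; rewrite cardTr; lia.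
have [wv wu wS] := TP _ wT.
have edge i j : i \in u |: (v |: T) -> j \in u |: (v |: T) -> i != j -> adj i j.
  have inS k : k \in u |: (v |: T) -> k \in S.
    by rewrite !inE => /or3P [/eqP->|/eqP->|/TP []].
  move=> /inS iS /inS jS ij; have /orP [/andP [i2 j2]|] := clS i j iS jS ij.
    move: i2 j2 ij; rewrite !inE => /orP [] /eqP -> /orP [] /eqP ->; rewrite ?eqxx //.
    by rewrite sa.
  by rewrite defect_eq0 // => /andP [].
have pos i : i \in [set u; v] -> i \in S -> ~~ switch_neg U neg i w.
  move=> i2 iS; have iw : i != w.
    by move: i2; rewrite !inE => /orP [] /eqP ->; rewrite eq_sym.
  have := clS i w iS wS iw; rewrite [w \in _]inE !in_set1 (negbTE wu) (negbTE wv) andbF /=.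
  by rewrite defect_eq0 // => /andP [].
have := @Kminus_free_clique_triangle n adj neg r.+1 U (u |: (v |: T)) u v w sn free.
rewrite (negbTE (pos u _ uS)) ?(negbTE (pos v _ vS)) ?inE ?eqxx ?orbT //=.
move=> H; suff: false by []; apply: H => //.
- by rewrite !cardsU1 !inE (negbTE uv) (negbTE uT) vT cardTr; lia.
- by rewrite wT !orbT.
- by split; rewrite // eq_sym.
Qed.

(** * Top eigenvectors of the copy of Gamma_{1,r-2} *)

Section StarEigenvector.
Variables (R : realType) (n r : nat) (a b : 'I_n) (Z : {set 'I_n}).
Variables (x : 'rV[R]_n) (l : R).
Hypotheses (ab : a != b) (aZ : a \notin Z).
Hypotheses (l_ge0 : 0 <= l) (xmin : forall i, x 0 a <= x 0 i).
Hypothesis eigen : x *m defect_mx R (star_defect a b Z) = l *: x.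

(** In this form, as l + 1 > 0, coordinates are compared through the subtracted terms alone. *)
Lemma star_eigen_eq j : (l + 1) * x 0 j = \sum_i x 0 i -
  ((if j == b then x 0 a *+ 2 else 0) +
  (if j == a then x 0 b *+ 2 + \sum_(i in Z) x 0 i else 0) +
  (if j \in Z then x 0 a else 0)).
Proof.
have := congr1 (fun y : 'rV[R]_n => y 0 j) eigen.
rewrite /= mul_defect_mx star_defect_col mxE mulrDl mul1r => <-.
by rewrite addrAC subrK.
Qed.

Let l1_gt0 : 0 < l + 1.
Proof. by rewrite ltr_wpDl. Qed.

(** The subtracted terms are 2 x_b plus the sum over Z at a, 2 x_a at b, and x_a or 0 elsewhere.
    Hence x_a < x_b, and x_b is below every remaining coordinate. *)
Lemma star_eigen_lt : b \notin Z -> 0 < x 0 a -> Z != set0 ->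
  forall i, i != a -> x 0 a < x 0 i.
Proof.
move=> bZ xa_gt0 /set0Pn [z zZ] i ia.
have xab : x 0 a < x 0 b.
  rewrite -(ltr_pM2l l1_gt0) !star_eigen_eq !eqxx (negbTE ab) (negbTE aZ).
  rewrite eq_sym (negbTE ab) (negbTE bZ) !addr0 !add0r ltrD2l ltrN2.
  apply: (@le_lt_trans _ _ (x 0 b *+ 2)); first by rewrite lerMn2r xmin.
  rewrite ltrDl (bigD1 z) //=.
  apply: ltr_pwDl; first exact: lt_le_trans xa_gt0 (xmin z).
  by apply: sumr_ge0 => k _; exact: le_trans (ltW xa_gt0) (xmin k).
have [->//|ib] := eqVneq i b.
apply: lt_trans xab _; rewrite -(ltr_pM2l l1_gt0) !star_eigen_eq.
rewrite eqxx eq_sym (negbTE ab) (negbTE bZ) (negbTE ia) (negbTE ib) !addr0 !add0r.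
rewrite ltrD2l ltrN2 mulr2n.
by case: ifP => _; rewrite ?ltrDl // addr_gt0.
Qed.

(** With x_a = 0 all other coordinates equal a common t > 0, and the equation at a reads (n - 1) t =
    2 t + (n - r) t. *)
Lemma star_eigen_zero : (r <= n)%N -> #|Z| = (n - r)%N -> x != 0 -> x 0 a = 0 ->
  (forall j, j != a -> 0 < x 0 j) /\ r = 3%N.
Proof.
move=> rn cardZ x_neq0 xa0; pose t := (\sum_i x 0 i) / (l + 1).
have xt j : j != a -> x 0 j = t.
  move=> ja; apply: (mulfI (lt0r_neq0 l1_gt0)).
  rewrite star_eigen_eq (negbTE ja) xa0 mul0rn !if_same !addr0 subr0.
  by rewrite /t mulrCA mulfV ?mulr1 ?lt0r_neq0.
have t_gt0 : 0 < t.
  have := xmin b; rewrite xa0 (xt b) 1?eq_sym // le_eqVlt => /orP [/eqP t0|//].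
  case/negP: x_neq0; apply/eqP/rowP => j; rewrite mxE.
  by have [->//|/xt ->] := eqVneq j a.
split=> [j /xt ->//|].
have sumx : \sum_i x 0 i = t *+ n.-1.
  rewrite (bigD1 a) //= xa0 add0r (eq_bigr (fun=> t)) => [|j /xt//].
  by rewrite sumr_const cardC1 card_ord.
have sumZ : \sum_(i in Z) x 0 i = t *+ (n - r).
  rewrite (eq_bigr (fun=> t)) ?sumr_const ?cardZ // => j jZ.
  by rewrite xt //; apply: contraNneq aZ => <-.
have := star_eigen_eq a; rewrite eqxx (negbTE ab) (negbTE aZ) add0r addr0.
rewrite xa0 mulr0 sumx sumZ (xt b) 1?eq_sym // -mulrnDr.
move/esym/eqP; rewrite subr_eq0 => /eqP /(mulrIn (lt0r_neq0 t_gt0)).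
have := ltn_ord a; lia.
Qed.

End StarEigenvector.

(* Case r = 3, where the top eigenvector may vanish at the vertex a: the
   inequality then says nothing about the edges at a, and the neighbours of a
   are found from unbalancedness and the absence of unbalanced K_4. *)
Lemma complete_but_one_switching n (adj neg : rel 'I_n) (U : {set 'I_n}) a b :
  (3 <= n)%N -> is_signed_graph adj neg -> unbalanced adj neg ->
  Kminus_free adj neg 4 ->
  defect adj (switch_neg U neg) a b = 2%N ->
  (forall i j, i != a -> j != a -> defect adj (switch_neg U neg) i j = 0%N) ->
  switching_equivalent adj neg (G1_adj n 3) (G1_neg n).
Proof.
move=> n3 [sa irr sn] unb free cab rest0.
have sN : symmetric (switch_neg U neg) by exact: switch_neg_sym.
have pos i j : i != a -> j != a -> i != j -> adj i j /\ switch_neg U neg i j = false.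
  move=> ia ja ij; have /eqP := rest0 i j ia ja.
  by rewrite defect_eq0 // => /andP [? /negbTE].
have /and3P [ab aab nab] : [&& a != b, adj a b & switch_neg U neg a b].
  by rewrite -defect_eq2 cab.
have ba : b != a by rewrite eq_sym.
have [w [wa aw nw]] : exists w, [/\ w != a, adj a w & switch_neg U neg a w = false].
  (* Switching also at a reverses exactly the edges at a. A negative edge must survive; it cannot
     avoid a, so it was a positive edge at a before. *)
  pose U' := [set i | (i \in U) (+) (i == a)].
  have U'E i j : switch_neg U' neg i j = switch_neg U neg i j (+) ((i == a) != (j == a)).
    rewrite /switch_neg !inE.
    by case: (neg i j); case: (i \in U); case: (j \in U); case: (i == a); case: (j == a).
  have [i [j [aij]]] := unbalanced_switch_neg_edge _ adj neg U' unb.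
  have ij : i != j by apply: contraTneq aij => ->; rewrite irr.
  rewrite U'E; have [ia|ia] := eqVneq i a; have [ja|ja] := eqVneq j a.
  - by rewrite ia ja eqxx in ij.
  - by rewrite addbT ia => /negbTE nn; exists j; rewrite -ia aij ia.
  - by rewrite addbT ja sN => /negbTE nn; exists i; rewrite -ja sa aij ja.
  by have [_ ->] := pos i j ia ja ij.
have wb : w != b by apply: contraFneq nw => ->.
(* Otherwise a, b, w, z is a K_4 containing the negative triangle a, b, w. *)
have nonadj z : z != a -> z != b -> z != w -> adj a z = false.
  move=> za zb zw; apply: contraTF isT => az.
  have := @Kminus_free_clique_triangle n adj neg 4 U [set a; b; w; z] a b w sn free.
  have [_ ->] : adj b w /\ switch_neg U neg b w = false by apply: pos; rewrite // eq_sym.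
  rewrite nw => H; suff: false by []; apply: H => //.
  - rewrite -!setUA !cardsU1 cards1 !inE.
    by rewrite (negbTE ab) !(eq_sym _ w) !(eq_sym _ z) (negbTE wa) (negbTE wb)
      (negbTE za) (negbTE zb) (negbTE zw).
  - have adja k : k \in [set a; b; w; z] -> k != a -> adj a k.
      by rewrite !inE -!orbA => /or4P [] /eqP -> //; rewrite eqxx.
    move=> i j iS jS ij; have [ia|ia] := eqVneq i a.
      by rewrite ia adja // eq_sym -ia.
    have [ja|ja] := eqVneq j a; first by rewrite sa ja adja.
    by have [] := pos i j ia ja ij.
  - by rewrite !inE !eqxx !orbT.
  - by split; rewrite // eq_sym.
pose Z := ~: [set a; b; w].
have aZ : a \notin Z by rewrite !inE eqxx.
have bZ : b \notin Z by rewrite !inE eqxx orbT.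
have cardZ : #|Z| = (n - 3)%N.
  have := cardsC [set a; b; w]; rewrite card_ord -/Z -setUA !cardsU1 cards1 !inE.
  by rewrite (negbTE ab) !(eq_sym _ w) (negbTE wa) (negbTE wb) /=; lia.
have star_a j : defect adj (switch_neg U neg) a j = star_defect a b Z a j.
  rewrite /star_defect eqxx (negbTE ab) (negbTE aZ) andbF addn0 /=.
  have [->|jb] := eqVneq j b; first by rewrite cab (negbTE bZ).
  have [->|ja] := eqVneq j a; first by rewrite (negbTE aZ) /defect eqxx.
  rewrite !inE (negbTE ja) (negbTE jb) /= add0n.
  rewrite /defect eq_sym (negbTE ja).
  by have [->|jw] := eqVneq j w; [rewrite aw nw | rewrite nonadj].
apply: (@defect_star_switching n 3 adj neg U Z a b) => // i j.
have [->//|ia] := eqVneq i a.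
have [->|ja] := eqVneq j a; first by rewrite defect_sym // star_a star_defect_sym.
by rewrite rest0 // /star_defect (negbTE ia) (negbTE ja) !andbF.
Qed.

(** * The index bound and its equality case *)

Theorem theorem1p8 (R : realType) (r n : nat) (adj neg : rel 'I_n) :
  (3 <= r)%N -> (r <= n)%N ->
  is_signed_graph adj neg ->
  unbalanced adj neg ->
  Kminus_free adj neg r.+1 ->
  lambda1 (sadj_mx R adj neg) <= lambda1 (sadj_mx R (G1_adj n r) (G1_neg n)) /\
  (lambda1 (sadj_mx R adj neg) = lambda1 (sadj_mx R (G1_adj n r) (G1_neg n)) <->
   switching_equivalent adj neg (G1_adj n r) (G1_neg n)).
Proof.
move=> r3 rn gr unb free; have [sa irr sn] := gr.
have r2 : (2 <= r)%N := ltnW r3.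
have n_gt0 : (0 < n)%N by lia.
have G1gr : is_signed_graph (G1_adj n r) (G1_neg n).
  by split; [exact: G1_symmetric | exact: G1_irreflexive | exact: G1_neg_symmetric].
set A := sadj_mx R adj neg; set L1 := lambda1 (sadj_mx R (G1_adj n r) (G1_neg n)).
suff [le eq_sw] : lambda1 A <= L1 /\
    (lambda1 A = L1 -> switching_equivalent adj neg (G1_adj n r) (G1_neg n)).
  by split=> //; split=> // /(switching_equivalent_lambda1 R _ _ _ _ _ n_gt0 gr G1gr).
have sA : A^T = A.
  by rewrite /A sadj_mx_defect // defect_mx_sym // => i j; exact: defect_sym.
have [/eigenvalueP [v vA v_neq0] _] := lambda1_spec _ _ A n_gt0 sA.
pose U := [set i | v 0 i < 0]; pose c := defect adj (switch_neg U neg).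
have csym i j : c i j = c j i by apply: defect_sym => //; exact: switch_neg_sym.
have [x [xE dx qx]] : exists y : 'rV[R]_n, [/\ forall i, y 0 ((1%g : {perm 'I_n}) i) =
    (-1) ^+ (i \in U) * v 0 i, dot y y = dot v v & qform (defect_mx R c) y = qform A v].
  apply: (signed_perm_isometry _ _ _ _ 1%g (fun i => (-1) ^+ (i \in U))).
    by move=> i; rewrite -expr2 sqrr_sign.
  move=> i j; rewrite !perm1 -sadj_mx_defect // !mxE /switch_neg.
  by case: (adj i j); case: (i \in U); case: (j \in U); case: (neg i j);
    rewrite /= ?expr0 ?expr1; ring.
have x_ge0 i : 0 <= x 0 i.
  rewrite -[i in x 0 i]perm1 xE inE; case: ltP => vi; last by rewrite mul1r.
  by rewrite expr1 mulN1r oppr_ge0 ltW.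
have x_neq0 : x != 0 by rewrite -dot_eq0 dx dot_eq0.
have x_gt0 := dot_gt0 _ _ _ x_neq0.
have {}qx : qform (defect_mx R c) x = lambda1 A * dot x x.
  by rewrite qx /qform vA dotZl dx.
have cneg : exists u w, c u w = 2%N.
  have [u [w [auw nuw]]] := unbalanced_switch_neg_edge _ _ _ U unb.
  exists u, w; apply/eqP; rewrite defect_eq2 auw nuw !andbT.
  by apply: contraTneq auw => ->; rewrite irr.
have cdiag i : c i i = 0%N by rewrite /c /defect eqxx.
have [a [b [Z [[ab aZ bZ cardZ] [xmin le_form eq_form]]]]] :=
  @star_defect_form_le R n r c x csym cdiag x_ge0
    (Kminus_free_clique_bound _ _ _ _ U r3 gr free) rn cneg.
set M := defect_mx R (star_defect a b Z).
have sM : M^T = M by apply: defect_mx_sym => i j; exact: star_defect_sym.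
have [_ qM] := lambda1_spec _ _ M n_gt0 sM.
have L1E : L1 = lambda1 M.
  have [p pE] := star_placement _ _ _ _ _ r2 rn ab aZ bZ cardZ.
  rewrite /L1 sadj_mx_defect; last exact: G1_irreflexive.
  apply/esym; apply: (lambda1_defect_perm _ _ _ _ p) => // i j.
    exact: star_defect_sym.
  by apply: defect_sym; [exact: G1_symmetric | exact: G1_neg_symmetric].
have qle : lambda1 A * dot x x <= qform M x.
  by rewrite -qx !qform_defect lerD2l lerN2.
split; first by rewrite L1E -(ler_pM2r x_gt0); exact: le_trans qle (qM x).
rewrite L1E => eqL; rewrite eqL in qle qx.
(* Under equality x attains the maximal Rayleigh quotient of the copy, so it is an eigenvector
   there. *)
have qMx : qform M x = lambda1 M * dot x x by apply/eqP; rewrite eq_le qle qM.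
have eigen := qform_max_eigenvector _ _ _ _ n_gt0 sM qMx.
have l_ge0 : 0 <= lambda1 M.
  by apply: (lambda1_ge0 _ _ _ a) => //; rewrite mxE eqxx star_defect_diag // subrr subr0.
have form_eq : defect_form (star_defect a b Z) x = defect_form c x.
  by move: qMx; rewrite -qx !qform_defect => /addrI /oppr_inj.
have [cab eq_star] := eq_form form_eq.
have [xa0|xa_neq0] := eqVneq (x 0 a) 0; last first.
  have xa_gt0 : 0 < x 0 a by rewrite lt_neqAle eq_sym xa_neq0 x_ge0.
  apply: (defect_star_switching _ _ _ _ U Z a b) => //.
  apply: eq_star => // Z0.
  exact: (star_eigen_lt R n a b Z x (lambda1 M)).
have [xpos r_eq3] := star_eigen_zero R n r a b Z x (lambda1 M) ab aZ l_ge0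
  xmin eigen rn cardZ x_neq0 xa0.
rewrite r_eq3 in rn free *.
apply: (complete_but_one_switching _ _ _ U a b) => // i j ia ja.
(* As x_a = 0 the star form vanishes, hence so does each nonnegative term of the form of c. The
   coordinates off a are positive, so all defects there are zero. *)
move: form_eq; rewrite star_defect_form xa0 !mul0r mul0rn add0r big1 => [|k _]; last first.
  by rewrite mul0r.
move/esym; rewrite mul0rn /defect_form => sum0.
have row0 : \sum_k x 0 i * x 0 k * (c i k)%:R = 0.
  apply: (psumr_eq0P _ sum0) => // k _.
  by apply: sumr_ge0 => h _; rewrite !mulr_ge0.
have /eqP := @psumr_eq0P _ _ xpredT _ (fun k _ => below_term_ge0 _ _ _ _ x_ge0 i k) row0 j isT.
by rewrite mulf_eq0 pnatr_eq0 mulf_eq0 (gt_eqF (xpos i ia)) (gt_eqF (xpos j ja)) => /eqP.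
Qed.
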